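(* Let $\Lambda\subset\mathbb{R}^2$ be an irrational lattice generated by $(1,1)$ and $(-\Delta,-\widetilde\Delta)$ with $\Delta>1$ and $-1<\widetilde\Delta<0$, and let $(a_i)_{i\in\mathbb{Z}}$, $(p_i)_{i\in\mathbb{Z}}$, $(q_i)_{i\in\mathbb{Z}}$, $(A_i)_{i\in\mathbb{Z}}$ and the boxes $B_n=(\alpha_n,\beta_n)\times(0,\widetilde\alpha_n+\widetilde\beta_n)$, $n\in\mathbb{Z}$, be as defined in the context. Writing $n\in\mathbb{Z}$ as $n=A_i+j$ with $i\in\mathbb{Z}$ and $0\le j<a_i$, the left and right sides of the $n$-th box are given by $$\alpha_n=\begin{cases}p_i-q_i\Delta&\text{if } i\text{ is odd},\\ j(p_i-q_i\Delta)+(p_{i-1}-q_{i-1}\Delta)&\text{if } i\text{ is even},\end{cases}$$ $$\beta_n=\begin{cases}j(p_i-q_i\Delta)+(p_{i-1}-q_{i-1}\Delta)&\text{if } i\text{ is odd},\\ p_i-q_i\Delta&\text{if } i\text{ is even}.\end{cases}$$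
   Context: A lattice is irrational if no two of its distinct points lie on the same horizontal or vertical line. An empty box is an open axis-parallel box containing no point of $\Lambda$; it is maximal if it is not properly contained in another empty box. It is bounded by a lattice point on a given side if that point lies in the relative interior of that side. The maximal empty boxes bounded on the bottom by $(0,0)$ are indexed by $n\in\mathbb{Z}$ in increasing order of height, with $B_0=(-\Delta,1)\times(0,1-\widetilde\Delta)$ (which is one of them). $B_n$ is bounded on the left by the lattice point $(\alpha_n,\widetilde\alpha_n)$ and on the right by the lattice point $(\beta_n,\widetilde\beta_n)$, and then $B_n=(\alpha_n,\beta_n)\times(0,\widetilde\alpha_n+\widetilde\beta_n)$. The positive integers $a_i$ are defined by the continued fraction expansions $\Delta=[a_0,a_1,a_2,\dots]$ and $-\widetilde\Delta=[0,a_{-1},a_{-2},\dots]$. The sequences $p_i,q_i$ ($i\in\mathbb{Z}$) are defined by $p_{-1}=0$, $p_0=1$, $q_{-1}=1$, $q_0=0$ and $p_{i+1}=a_ip_i+p_{i-1}$, $q_{i+1}=a_iq_i+q_{i-1}$ for all $i\in\mathbb{Z}$ (used backwards as $p_{i-1}=p_{i+1}-a_ip_i$, $q_{i-1}=q_{i+1}-a_iq_i$ for negative indices). Finally $A_i=\sum_{k=0}^{i-1}a_k$ for $i\ge0$ and $A_i=-\sum_{k=i}^{-1}a_k$ for $i<0$. *)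

(* Defs.v *)
From mathcomp Require Import all_boot all_order all_algebra.
From mathcomp Require Import all_classical all_reals all_analysis.

Set Implicit Arguments.
Unset Strict Implicit.
Unset Printing Implicit Defensive.

Import Order.TTheory GRing.Theory Num.Theory.
Import numFieldNormedType.Exports.

Local Open Scope classical_set_scope.
Local Open Scope ring_scope.

Definition plane_lattice (R : realType) (u v : R * R) : set (R * R) :=
  [set w | exists m n : int, w = u *~ m + v *~ n].

Definition irrational_lattice (R : realType) (L : set (R * R)) : Prop :=
  forall u v, L u -> L v -> u <> v -> u.1 <> v.1 /\ u.2 <> v.2.

(* The box ]left, right[ x ]bottom, top[; the four numbers are unconstrained
   here, and [empty_box] requires left < right and bottom < top, so that a
   degenerate box, which has no points at all, does not count as empty. *)
Record box (R : realType) :=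
  Box { left : R; right : R; bottom : R; top : R }.

Definition box_set (R : realType) (B : box R) : set (R * R) :=
  `]left B, right B[%classic `*` `]bottom B, top B[%classic.

Definition height (R : realType) (B : box R) : R := top B - bottom B.

Definition empty_box (R : realType) (L : set (R * R)) (B : box R) : Prop :=
  [/\ left B < right B, bottom B < top B & box_set B `&` L = set0].

Definition maximal_empty_box (R : realType) (L : set (R * R)) (B : box R) :
    Prop :=
  empty_box L B /\
  forall C : box R, empty_box L C -> ~ (box_set B `<` box_set C).

Definition bounded_left_by (R : realType) (L : set (R * R)) (B : box R)
    (u : R * R) : Prop :=
  [/\ L u, u.1 = left B & bottom B < u.2 < top B].

Definition bounded_right_by (R : realType) (L : set (R * R)) (B : box R)
    (u : R * R) : Prop :=
  [/\ L u, u.1 = right B & bottom B < u.2 < top B].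

Definition bounded_bottom_by (R : realType) (L : set (R * R)) (B : box R)
    (u : R * R) : Prop :=
  [/\ L u, u.2 = bottom B & left B < u.1 < right B].

Definition indexed_by_height (R : realType) (P : box R -> Prop)
    (B : int -> box R) : Prop :=
  [/\ forall n, P (B n),
      forall C, P C -> exists n, B n = C
    & forall m n : int, m < n -> height (B m) < height (B n)].

(* [c 0, c 1, ..., c n] = c 0 + 1 / (c 1 + 1 / (... + 1 / c n)) *)
Fixpoint finite_cfrac (R : realType) (c : nat -> int) (n : nat) : R :=
  if n is n'.+1 then (c 0)%:~R + (finite_cfrac R (fun k => c k.+1) n')^-1
  else (c 0)%:~R.

Definition is_cfrac (R : realType) (x : R) (c : nat -> int) : Prop :=
  finite_cfrac R c n @[n --> \oo] --> x.

(* [Negz m] is -(m + 1), so the second sum runs over a (-1), ..., a i. *)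
Definition signed_partial_sum (a : int -> int) (i : int) : int :=
  match i with
  | Posz m => \sum_(0 <= k < m) a (Posz k)
  | Negz m => - \sum_(0 <= k < m.+1) a (Negz k)
  end.

(* Main.v *)
Require Import Defs.
From mathcomp Require Import all_boot all_order all_algebra.
From mathcomp Require Import all_classical all_reals all_analysis.
From mathcomp Require Import ring lra zify.

Import Order.TTheory GRing.Theory Num.Theory.
Import numFieldNormedType.Exports.

Local Open Scope classical_set_scope.
Local Open Scope ring_scope.

(** Put [v i = p i (1, 1) + q i (- Delta, - Delta')], so that [v (-1)] and [v 0]
    are the two given generators and [v (i + 1) = a i v i + v (i - 1)]. Any two
    consecutive [v i] generate the lattice, hence so do [v i] and
    [j v i + v (i - 1)].

    The ordinates of the [v i] are all positive, while their abscissas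
    [p i - q i Delta] are positive for even [i] and negative for odd [i]. In one
    direction of the index the recurrence adds terms of the same sign, so this is
    clear; in the other direction the [v i] are remainders of the Euclidean
    algorithm, whose successive ratios are the complete quotients of the given
    continued fraction, hence positive ([cfrac_remainder_gt0]).

    Thus for [0 <= j <= a i] the vectors [v i] and [j v i + v (i - 1)] form a
    basis of the lattice with one vector [w] on the left and one vector [u] on
    the right of the vertical axis, both in the upper half plane. For such a
    basis the box [(w.1, u.1) x (0, w.2 + u.2)] is empty, and it is maximal
    because [w], [u], [0] and [w + u] lie on its sides
    ([reduced_basis_maximal]). Replacing [w] or [u] by [w + u], whichever gives
    again such a basis, produces the next higher box: a maximal box that is
    strictly higher than the first one is at least as high as the second
    ([maximal_box_height], [consecutive_boxes]).

    Passing from [(i, j)] to [(i, j + 1)] is such a replacement, and the pairs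
    [(i, a i)] and [(i + 1, 0)] give the same box. As the box for [(0, 0)] is
    [B 0], following the chain upwards and downwards identifies [B (A_i + j)]
    with the box for [(i, j)] ([chain_boxE]), from which both sides are read
    off. *)

(** * Integer indices *)

Lemma int_ind_iff (P : int -> Prop) :
  P 0 -> (forall i, P i <-> P (i + 1)) -> forall i, P i.
Proof.
move=> P0 PS [n|n].
  by elim: n => [//|n IH]; rewrite -addn1 PoszD; apply/(PS n).
elim: n => [|n IH]; first by apply/PS.
by apply/PS; rewrite (_ : Negz n.+1 + 1 = Negz n) //; lia.
Qed.

Lemma odd_absz_succ (i : int) : odd `|(i + 1)%R|%N = ~~ odd `|i|%N.
Proof.
case: i => [n|[|n]] //; first by rewrite -PoszD /= addn1.
by rewrite (_ : Negz n.+1 + 1 = Negz n) /= ?negbK //; lia.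
Qed.

Lemma signed_partial_sum_succ (a : int -> int) (i : int) :
  signed_partial_sum a (i + 1) = signed_partial_sum a i + a i.
Proof.
case: i => [n|[|n]].
- by rewrite -PoszD addn1 /= big_nat_recr.
- by rewrite /= !big_nat1 big_nil addNr.
- rewrite (_ : Negz n.+1 + 1 = Negz n); last by lia.
  by rewrite /= [in RHS]big_nat_recr //= opprD subrK.
Qed.

(** * Positivity of continued fraction remainders *)

Section ContinuedFractions.
Context {R : realType}.

(** The lower bound makes every denominator of a continued fraction at least
    [1]; the upper bound then keeps the fractional part away from [0], so that
    strict inequalities survive the passage to the limit. *)
Lemma finite_cfrac_bounds (c : nat -> int) (n : nat) :
  (forall k, 0 < c k) ->
  (c 0%N)%:~R <= finite_cfrac R c n <= (c 0%N)%:~R + 1.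
Proof.
elim: n c => [|n IH] c c_gt0 /=; first by rewrite lexx lerDl ler01.
have /andP[F_ge _] := IH (fun k => c k.+1) (fun k => c_gt0 k.+1).
have F_ge1 : 1 <= finite_cfrac R (fun k => c k.+1) n.
  by apply: le_trans F_ge; rewrite -[1]/(1%:~R) ler_int -gtz0_ge1.
have F_gt0 := lt_le_trans ltr01 F_ge1.
by rewrite lerDl invr_ge0 ltW //= lerD2l invf_le1.
Qed.

(** The Gauss map acts on convergence of partial fractions, not only on formal
    expansions: the tail converges because the inverse of the fractional part
    does, the limit of the latter being nonzero. *)
Lemma is_cfrac_tail (t : R) (c : nat -> int) :
  (forall k, 0 < c k.+1) -> is_cfrac t c ->
  (c 0%N)%:~R < t /\ is_cfrac (t - (c 0%N)%:~R)^-1 (fun k => c k.+1).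
Proof.
move=> c_gt0; rewrite /is_cfrac -cvg_shiftS => cvg_t.
set c0 : R := (c 0%N)%:~R; set c1 : R := (c 1%N)%:~R + 1.
pose F n := finite_cfrac R (fun k => c k.+1) n.
have F_gt0 n : 0 < F n.
  have /andP[+ _] := finite_cfrac_bounds _ n c_gt0.
  by apply: lt_le_trans; rewrite ltr0z.
have t_gt : c0 < t.
  apply: (@lt_le_trans _ _ (c0 + c1^-1)).
    by rewrite ltrDl invr_gt0 addr_gt0 // ltr0z.
  apply: (cvgr_to_ge cvg_t); near=> n => /=.
  rewrite lerD2l lef_pV2 ?posrE ?F_gt0 ?addr_gt0 ?ltr0z //.
  by have /andP[] := finite_cfrac_bounds _ n c_gt0.
split=> //.
have cvg_inv : (finite_cfrac R c n.+1 - c0) @[n --> \oo] --> t - c0.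
  exact: cvgB cvg_t (cvg_cst _).
have tc0 : t - c0 != 0 by rewrite subr_eq0 gt_eqF.
apply: cvg_trans (cvgV tc0 cvg_inv); apply: near_eq_cvg; near=> n => /=.
by rewrite addrAC subrr add0r invrK.
Unshelve. all: by end_near.
Qed.

(** Here [z] is the sequence of remainders of the Euclidean algorithm that
    starts from [z 0] and [z 1]. For positive [k] the ratio [z k / z k.+1] is
    the value of the continued fraction of [c k], [c k.+1], and so on, hence
    positive, so no remainder vanishes or changes sign. *)
Lemma cfrac_remainder_gt0 (t : R) (c : nat -> int) (z : nat -> R) :
  (forall k, 0 < c k.+1) -> is_cfrac t c ->
  z 0%N = t * z 1%N -> (forall k, z k = (c k)%:~R * z k.+1 + z k.+2) ->
  0 < z 1%N -> forall k, 0 < z k.+1.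
Proof.
move=> c_gt0 tc z0 zS z1_gt0 k.
elim: k t c z c_gt0 tc z0 zS z1_gt0 => // k IH t c z c_gt0 tc z0 zS z1_gt0.
have [t_gt tc'] := is_cfrac_tail _ _ c_gt0 tc.
have z2 : z 2%N = (t - (c 0%N)%:~R) * z 1%N.
  by rewrite mulrBl -z0 (zS 0%N) addrAC subrr add0r.
apply: (IH _ (fun k => c k.+1) (fun k => z k.+1)) tc' _ _ _ => //=.
  by rewrite z2 mulKf // subr_eq0 gt_eqF.
by rewrite z2 mulr_gt0 // subr_gt0.
Qed.

Lemma recurrence_gt0 (c z : nat -> R) :
  (forall k, 0 < c k) -> (forall k, z k.+2 = c k * z k.+1 + z k) ->
  0 < z 0%N -> 0 < z 1%N -> forall k, 0 < z k.
Proof.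
move=> c_gt0 zS z0 z1 k; suff [] : 0 < z k /\ 0 < z k.+1 by [].
elim: k => [//|k [zk zk1]]; split=> //.
by rewrite zS addr_gt0 // mulr_gt0.
Qed.

(** For nonnegative [i] the numbers [(-1)^i x i] are the Euclidean remainders
    of [t] and [1], and [t] being the value of the continued fraction forces
    them to stay positive; for negative [i] they grow, as one runs the same
    recurrence in the direction in which all terms are added. *)
Lemma alternating_gt0 (a : int -> int) (x : int -> R) (t : R) :
  (forall i, 0 < a i) ->
  (forall i, x (i + 1) = (a i)%:~R * x i + x (i - 1)) ->
  0 < t -> is_cfrac t (fun k : nat => a k%:Z) ->
  x 0 = 1 -> x (-1) = - t ->
  forall i, 0 < (if odd `|i|%N then - x i else x i).
Proof.
move=> a_gt0 xS t_gt0 cf x0 x_1.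
pose s i := if odd `|i|%N then - x i else x i.
have sS i : s (i - 1) = (a i)%:~R * s i + s (i + 1).
  have par := odd_absz_succ (i - 1); rewrite subrK in par.
  rewrite /s odd_absz_succ xS par.
  by case: (odd `|(i - 1)%R|%N) => /=; ring.
have s0 : s 0 = 1 by rewrite /s.
have s_1 : s (-1) = t by rewrite /s /= x_1 opprK.
move=> i; rewrite -/(s i); have [[k ->]|[k ->]] :
    (exists k : nat, i = k%:Z) \/ (exists k : nat, i = - k%:Z).
  by case: i => n; [left; exists n | right; exists n.+1].
- have -> : k%:Z = (k.+1)%:Z - 1 by lia.
  apply: (cfrac_remainder_gt0 t (fun k => a k%:Z) (fun k => s (k%:Z - 1)))
    => // [|m|] /=.
  - by rewrite subrr s0 s_1 mulr1.
  - by rewrite sS; congr (_ * s _ + s _); lia.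
  - by rewrite subrr s0.
apply: (recurrence_gt0 (fun k => (a (- k.+1%:Z))%:~R) (fun k => s (- k%:Z)))
    => [m|m||] /=.
- by rewrite ltr0z.
- have -> : - m.+2%:Z = - m.+1%:Z - 1 by lia.
  by rewrite sS; congr (_ + s _); lia.
- by rewrite oppr0 s0.
- by rewrite s_1.
Qed.

(** Mirror image of [alternating_gt0]: now the Euclidean algorithm runs towards
    negative indices, driven by [a (-1)], [a (-2)], and so on, and the easy
    growing half is that of nonnegative indices. *)
Lemma increasing_gt0 (a : int -> int) (y : int -> R) (t : R) :
  (forall i, 0 < a i) ->
  (forall i, y (i + 1) = (a i)%:~R * y i + y (i - 1)) ->
  0 < t -> is_cfrac t (fun k : nat => if k == 0%N then 0 else a (- k%:Z)) ->
  y 0 = 1 -> y (-1) = t ->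
  forall i, 0 < y i.
Proof.
move=> a_gt0 yS t_gt0 cf y0 y_1 [k|k].
  have -> : Posz k = (k.+1)%:Z - 1 by lia.
  apply: (recurrence_gt0 (fun k => (a k%:Z)%:~R) (fun k => y (k%:Z - 1)))
    => [m|m||] /=.
  - by rewrite ltr0z.
  - have -> : m.+2%:Z - 1 = m%:Z + 1 by lia.
    by rewrite yS; congr (_ * y _ + _); lia.
  - by rewrite y_1.
  - by rewrite y0.
have -> : Negz k = 1 - (k.+2)%:Z by lia.
(* The expansion of [t] starts with [0], so its first division only swaps
   [y (-1)] and [1]: the sequence begins [y (-1), y 0, y (-1), y (-2), ...]. *)
apply: (cfrac_remainder_gt0 t _
  (fun m => if m == 0%N then y (-1) else y (1 - m%:Z)) _ cf)
  => [m||[|m]|] //=.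
- by rewrite subrr y0 mulr1.
- by rewrite mul0r add0r; congr y; lia.
- have -> : 1 - m.+1%:Z = - m.+1%:Z + 1 by lia.
  by rewrite yS; congr (_ * y _ + y _); lia.
- by rewrite subrr y0.
Qed.

End ContinuedFractions.

(** * Empty boxes spanned by a lattice basis *)

Section Boxes.
Context {R : realType}.
Local Notation bottom := Defs.bottom.
Implicit Types (L : set (R * R)) (u v w : R * R) (B C : box R).

Lemma fst_comb u v (m n : int) :
  (u *~ m + v *~ n).1 = m%:~R * u.1 + n%:~R * v.1.
Proof. by rewrite (raddfD (@fst R R)) !(raddfMz (@fst R R)) !mulrzl. Qed.

Lemma snd_comb u v (m n : int) :
  (u *~ m + v *~ n).2 = m%:~R * u.2 + n%:~R * v.2.
Proof. by rewrite (raddfD (@snd R R)) !(raddfMz (@snd R R)) !mulrzl. Qed.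

Lemma fst_shear u v (j : int) : (u *~ j + v).1 = j%:~R * u.1 + v.1.
Proof. by have := fst_comb u v j 1; rewrite mulr1z mul1r. Qed.

Lemma snd_shear u v (j : int) : (u *~ j + v).2 = j%:~R * u.2 + v.2.
Proof. by have := snd_comb u v j 1; rewrite mulr1z mul1r. Qed.

Lemma plane_latticeC u v : plane_lattice u v = plane_lattice v u.
Proof. by apply/seteqP; split=> z [m [n ->]]; exists n, m; rewrite addrC. Qed.

Lemma plane_lattice_shear u v (j : int) :
  plane_lattice (u *~ j + v) u = plane_lattice v u.
Proof.
apply/seteqP; split=> z [m [n ->]].
  exists m, (j * m + n); rewrite mulrzDl mulrzDr -mulrzA.
  by rewrite addrAC addrC.
exists m, (n - j * m); rewrite mulrzDl mulrzBr -mulrzA.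
by rewrite [u *~ _ + v *~ m]addrC addrACA subrr addr0.
Qed.

(** A basis of the lattice whose two vectors lie above the origin, one on each
    side: such a pair bounds, together with the origin and [w + u], a maximal
    empty box. *)
Definition reduced_basis L w u :=
  [/\ L = plane_lattice w u, w.1 < 0 < u.1, 0 < w.2 & 0 < u.2].

Definition basis_box w u : box R := Box w.1 u.1 0 (w.2 + u.2).

(** Write a lattice point as [m w + n u]. If [m] and [n] are both at most [0]
    it is not above the bottom side, if both are at least [1] it is not below
    the top side, and otherwise it lies beyond [w] or beyond [u]
    horizontally. *)
Lemma reduced_basis_empty_box L w u :
  reduced_basis L w u -> empty_box L (basis_box w u).
Proof.
move=> [-> /andP[w1 u1] w2 u2]; split=> /=; [lra|lra|].
apply/seteqP; split=> // z [+ [m [n zE]]].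
rewrite /box_set /basis_box /= !in_itv /= => -[].
rewrite zE fst_comb snd_comb => /andP[x1 x2] /andP[y1 y2].
have le0 (k : int) : (k <= 0) = (k%:~R <= 0 :> R) by rewrite lerz0.
have ge1 (k : int) : (1 <= k) = (1 <= k%:~R :> R) by rewrite ler1z.
have [n0|n1] : n <= 0 \/ 1 <= n by lia.
  have [m0|m1] : m <= 0 \/ 1 <= m by lia.
    by move: n0 m0; rewrite !le0; nra.
  by move: n0 m1; rewrite le0 ge1; nra.
have [m0|m1] : m <= 0 \/ 1 <= m by lia.
  by move: n1 m0; rewrite le0 ge1; nra.
by move: n1 m1; rewrite !ge1; nra.
Qed.

Lemma subset_oo_itv (a b c d : R) : a < b ->
  `]a, b[%classic `<=` `]c, d[%classic -> c <= a /\ b <= d.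
Proof.
move=> ab sub; split; rewrite leNgt; apply/negP => lt.
  have ab' : a < Num.min b c by rewrite lt_min ab.
  have [h1] := midf_lt ab'; rewrite lt_min => /andP[h2 h3].
  by have := sub _ (_ : `]a, b[%classic ((a + Num.min b c) / 2));
    rewrite /= !in_itv /= h1 h2 => /(_ isT) /andP[h4 _]; lra.
have ab' : Num.max a d < b by rewrite gt_max ab.
have [+ h1] := midf_lt ab'; rewrite gt_max => /andP[h2 h3].
by have := sub _ (_ : `]a, b[%classic ((Num.max a d + b) / 2));
  rewrite /= !in_itv /= h1 h2 => /(_ isT) /andP[_ h4]; lra.
Qed.

Lemma empty_boxP L C z : empty_box L C -> L z ->
  ~ (left C < z.1 < right C /\ bottom C < z.2 < top C).
Proof.
by move=> [_ _ CL] Lz [z1 z2]; rewrite -[False]/(set0 z) -CL.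
Qed.

(** The four sides carry the lattice points [w], [u], [0] and [w + u] in their
    relative interiors, and each of these blocks any enlargement. *)
Lemma reduced_basis_maximal L w u : reduced_basis L w u ->
  maximal_empty_box L (basis_box w u) /\
  bounded_bottom_by L (basis_box w u) (0, 0).
Proof.
move=> red; have emp := reduced_basis_empty_box _ _ _ red.
case: red => LE /andP[w1 u1] w2 u2.
have L0 : L (0, 0) by rewrite LE; exists 0, 0; rewrite !mulr0z addr0.
have Lw : L w by rewrite LE; exists 1, 0; rewrite mulr0z addr0.
have Lu : L u by rewrite LE; exists 0, 1; rewrite mulr0z add0r.
have Lwu : L (w + u) by rewrite LE; exists 1, 1.
split; last by split=> //=; rewrite w1.
split=> // C Cemp [sub nsub].
have [cl cr] : left C <= w.1 /\ u.1 <= right C.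
  apply: subset_oo_itv; first lra.
  move=> x xI; have [] // := sub (x, (w.2 + u.2) / 2); split=> //=.
  by rewrite in_itv /=; lra.
have [cb ct] : bottom C <= 0 /\ w.2 + u.2 <= top C.
  apply: subset_oo_itv; first lra.
  move=> y yI; have [] // := sub ((w.1 + u.1) / 2, y); split=> //=.
  by rewrite in_itv /=; lra.
have := empty_boxP _ _ _ Cemp L0; have := empty_boxP _ _ _ Cemp Lw.
have := empty_boxP _ _ _ Cemp Lu; have := empty_boxP _ _ _ Cemp Lwu.
rewrite /= => nwu nu nw n0; apply: nsub.
have cl' : w.1 <= left C by rewrite leNgt; apply/negP=> h; apply: nw; split; lra.
have cr' : right C <= u.1 by rewrite leNgt; apply/negP=> h; apply: nu; split; lra.
have cb' : 0 <= bottom C by rewrite leNgt; apply/negP=> h; apply: n0; split; lra.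
have ct' : top C <= w.2 + u.2.
  by rewrite leNgt; apply/negP=> h; apply: nwu; split; lra.
by move=> z [/=]; rewrite !in_itv /= => h1 h2; split; rewrite /= in_itv /=; lra.
Qed.

(** A box reaching above both [w] and [u] must fit horizontally between them,
    so if it stopped below [w + u] it could be enlarged to the empty box
    spanned by [w] and [u]. *)
Lemma maximal_box_height L C w u :
  maximal_empty_box L C -> bounded_bottom_by L C (0, 0) ->
  reduced_basis L w u -> w.2 < top C -> u.2 < top C ->
  w.2 + u.2 <= top C.
Proof.
move=> [Cemp Cmax] [_ /= b0 /andP[l0 r0]] red wt ut.
have emp := reduced_basis_empty_box _ _ _ red.
case: red => LE /andP[w1 u1] w2 u2.
have Lw : L w by rewrite LE; exists 1, 0; rewrite mulr0z addr0.
have Lu : L u by rewrite LE; exists 0, 1; rewrite mulr0z add0r.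
have := empty_boxP _ _ _ Cemp Lw; have := empty_boxP _ _ _ Cemp Lu.
move=> nu nw.
have cl : w.1 <= left C by rewrite leNgt; apply/negP=> h; apply: nw; split; lra.
have cr : right C <= u.1 by rewrite leNgt; apply/negP=> h; apply: nu; split; lra.
rewrite leNgt; apply/negP=> ct; apply: (Cmax _ emp); split.
  by move=> z [/=]; rewrite !in_itv /= => h1 h2; split; rewrite /= in_itv /=; lra.
(* Strictness: a point on the top side of [C] is not in the open box [C]. *)
move=> sub; have [] // := sub ((left C + right C) / 2, top C).
  by split; rewrite /= in_itv /=; lra.
by rewrite /= !in_itv /=; lra.
Qed.

(** By [maximal_box_height] no maximal box has a height strictly between those
    of the two boxes in question, so that an enumeration by increasing height
    lists them one right after the other. The equivalence serves to move along
    the enumeration in both directions. *)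
Lemma consecutive_boxes L (B : int -> box R) w u w' u' (n : int) :
  indexed_by_height
    (fun C => maximal_empty_box L C /\ bounded_bottom_by L C (0, 0)) B ->
  reduced_basis L w u -> reduced_basis L w' u' ->
  w'.2 <= w.2 + u.2 -> u'.2 <= w.2 + u.2 -> w.2 + u.2 < w'.2 + u'.2 ->
  B n = basis_box w u <-> B (n + 1) = basis_box w' u'.
Proof.
move=> [Bmax Bsurj Bmono] red red' w't u't lt_top.
have heightE m : height (B m) = top (B m).
  by have [_ [_ /= b0 _]] := Bmax m; rewrite /height -b0 subr0.
have mono m m' : top (B m) < top (B m') -> m < m'.
  rewrite -!heightE; case: (ltgtP m m') => // [/Bmono h|->]; lra.
have no_gap m : ~ (w.2 + u.2 < top (B m) < w'.2 + u'.2).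
  move=> /andP[lo hi]; have [Bm Bb] := Bmax m.
  have := maximal_box_height _ _ _ _ Bm Bb red'.
  by move=> /(_ ltac:(lra) ltac:(lra)); lra.
have [k Ek] := Bsurj _ (reduced_basis_maximal _ _ _ red).
have [k' Ek'] := Bsurj _ (reduced_basis_maximal _ _ _ red').
have top_k : top (B k) = w.2 + u.2 by rewrite Ek.
have top_k' : top (B k') = w'.2 + u'.2 by rewrite Ek'.
have kk' : k' = k + 1.
  have lt_k : k < k' by apply: mono; rewrite top_k top_k'.
  have [//|lt_k1] : k' = k + 1 \/ k + 1 < k' by lia.
  have [lt1 lt2] : k < k + 1 /\ k + 1 < k' by lia.
  case: (no_gap (k + 1)); rewrite -top_k -top_k' -!heightE.
  by rewrite !Bmono.
have inj m m' : top (B m) = top (B m') -> m = m'.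
  by rewrite -!heightE => E; case: (ltgtP m m') => // /Bmono; rewrite E ltxx.
split=> E.
  by rewrite -Ek' kk'; congr (B (_ + 1)); apply: inj; rewrite E Ek.
rewrite -Ek; congr B; have : n + 1 = k' by apply: inj; rewrite E Ek'.
lia.
Qed.

End Boxes.

(** * The chain of boxes attached to the convergents *)

Section Chain.
Context {R : realType}.
Context (L : set (R * R)) (a : int -> int) (v : int -> R * R).

(** The point [v i] lies to the right of the vertical axis for even [i] and to
    its left for odd [i]; the other side is bounded by the intermediate
    convergent [j v i + v (i - 1)]. *)
Definition chain_left (i j : int) : R * R :=
  if odd `|i|%N then v i else v i *~ j + v (i - 1).

Definition chain_right (i j : int) : R * R :=
  if odd `|i|%N then v i *~ j + v (i - 1) else v i.

Definition chain_box (i j : int) : box R :=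
  basis_box (chain_left i j) (chain_right i j).

Context (a_gt0 : forall i, 0 < a i).
Context (vS : forall i, v (i + 1) = v i *~ a i + v (i - 1)).
Context (v_basis : L = plane_lattice (v 0) (v (-1))).
Context (v1_sign : forall i, 0 < (if odd `|i|%N then - (v i).1 else (v i).1)).
Context (v2_gt0 : forall i, 0 < (v i).2).

Lemma chain_lattice (i : int) : L = plane_lattice (v i) (v (i - 1)).
Proof.
elim/int_ind_iff: i => [//|i].
by rewrite vS addrK plane_lattice_shear plane_latticeC.
Qed.

Lemma snd_chain_gt0 (i j : int) : 0 <= j -> 0 < (v i *~ j + v (i - 1)).2.
Proof.
by move=> j0; rewrite snd_shear ltr_wpDl // mulr_ge0 ?ler0z // ltW.
Qed.

(** The abscissa of [j v i + v (i - 1)] is best read as that of [v (i + 1)]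
    moved away from zero by [(a i - j) v i]: walking from [v (i - 1)] towards
    the axis in steps [v i], one is still on the same side after [a i] steps,
    namely at [v (i + 1)]. *)
Lemma chain_reduced (i j : int) : 0 <= j <= a i ->
  reduced_basis L (chain_left i j) (chain_right i j).
Proof.
move=> /andP[j0 ja].
have y_gt0 := snd_chain_gt0 i j j0.
have Lij : L = plane_lattice (v i *~ j + v (i - 1)) (v i).
  by rewrite plane_lattice_shear plane_latticeC -chain_lattice.
have xE : (v i *~ j + v (i - 1)).1 = (v (i + 1)).1 - (a i - j)%:~R * (v i).1.
  by rewrite vS !fst_shear intrB; ring.
have d_ge0 : 0 <= (a i - j)%:~R :> R by rewrite ler0z subr_ge0.
have := v1_sign i; have := v1_sign (i + 1); have := v2_gt0 i.
rewrite odd_absz_succ /reduced_basis /chain_left /chain_right.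
move: (v i *~ j + v (i - 1)) y_gt0 Lij xE => w y_gt0 Lij xE.
case: (odd `|i|%N) => /= y x1 x0; split=> //.
- by rewrite Lij plane_latticeC.
- by rewrite xE; nra.
- by rewrite xE; nra.
Qed.

Context (B : int -> box R).
Context (B_indexed : indexed_by_height
  (fun C => maximal_empty_box L C /\ bounded_bottom_by L C (0, 0)) B).
Context (B0 : B 0 = chain_box 0 0).

(** One step adds the top point [w + u] of the current box as the new bounding
    point on one side, which makes the new box the next one in height. *)
Lemma chain_boxE_row (i : int) (j : nat) (n : int) : j%:Z <= a i ->
  B n = chain_box i 0 <-> B (n + j%:Z) = chain_box i j%:Z.
Proof.
elim: j => [|j IH] ja; first by rewrite addr0.
rewrite IH; last by lia.
rewrite -addn1 PoszD addrA.
apply: (consecutive_boxes L) => //; try (apply: chain_reduced; lia).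
all: have := snd_shear (v i) (v (i - 1)) (Posz j).
all: have := snd_shear (v i) (v (i - 1)) (Posz j + 1).
all: have := v2_gt0 i; have := snd_chain_gt0 i (Posz j) isT.
all: rewrite intrD /chain_left /chain_right.
all: move: (v i *~ j%:Z + v (i - 1)) (v i *~ (j%:Z + 1) + v (i - 1)) => w w'.
all: by case: (odd `|i|%N) => /=; lra.
Qed.

(** After [a i] steps the moving side has reached [v (i + 1)], and the two sides
    exchange their roles. *)
Lemma chain_box_wrap (i : int) : chain_box i (a i) = chain_box (i + 1) 0.
Proof.
rewrite /chain_box /chain_left /chain_right odd_absz_succ vS addrK.
by case: odd; rewrite /= mulr0z add0r.
Qed.

Lemma chain_boxE (i j : int) : 0 <= j <= a i ->
  B (signed_partial_sum a i + j) = chain_box i j.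
Proof.
move=> /andP[j0 ja].
have -> : j = `|j|%N%:Z by rewrite gez0_abs.
apply/chain_boxE_row; first by rewrite gez0_abs.
move: i {j j0 ja}; elim/int_ind_iff => [|i].
  by rewrite /= big_nil.
rewrite signed_partial_sum_succ -chain_box_wrap.
have <- : `|a i|%N%:Z = a i by rewrite gez0_abs // ltW.
by apply: chain_boxE_row; rewrite gez0_abs // ltW.
Qed.

End Chain.

(** * Identification of the boxes *)

Theorem proposition3p4 (R : realType) (Delta Delta' : R)
    (hDelta : 1 < Delta) (hDelta' : -1 < Delta' < 0)
    (Lambda : set (R * R))
    (hLambda : Lambda = plane_lattice (1, 1) (- Delta, - Delta'))
    (hirr : irrational_lattice Lambda)
    (a : int -> int) (ha : forall i, 0 < a i)
    (haDelta : is_cfrac Delta (fun k : nat => a k%:Z))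
    (haDelta' : is_cfrac (- Delta')
       (fun k : nat => if k == 0%N then 0 else a (- k%:Z)))
    (p q : int -> int)
    (hp_1 : p (-1) = 0) (hp0 : p 0 = 1)
    (hq_1 : q (-1) = 1) (hq0 : q 0 = 0)
    (hp : forall i, p (i + 1) = a i * p i + p (i - 1))
    (hq : forall i, q (i + 1) = a i * q i + q (i - 1))
    (B : int -> box R)
    (hB : indexed_by_height
       (fun C => maximal_empty_box Lambda C /\
                 bounded_bottom_by Lambda C (0, 0)) B)
    (hB0 : B 0 = Box (- Delta) 1 0 (1 - Delta'))
    (alpha alpha' beta beta' : int -> R)
    (halpha : forall n, bounded_left_by Lambda (B n) (alpha n, alpha' n))
    (hbeta : forall n, bounded_right_by Lambda (B n) (beta n, beta' n)) :
  forall n i j : int, n = signed_partial_sum a i + j -> 0 <= j < a i ->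
    alpha n =
      (if odd `|i|%N then (p i)%:~R - (q i)%:~R * Delta
       else j%:~R * ((p i)%:~R - (q i)%:~R * Delta)
            + ((p (i - 1))%:~R - (q (i - 1))%:~R * Delta))
    /\
    beta n =
      (if odd `|i|%N
       then j%:~R * ((p i)%:~R - (q i)%:~R * Delta)
            + ((p (i - 1))%:~R - (q (i - 1))%:~R * Delta)
       else (p i)%:~R - (q i)%:~R * Delta).
Proof.
move=> n i j -> /andP[j0 ja].
pose v i := (1, 1) *~ p i + (- Delta, - Delta') *~ q i : R * R.
have vS k : v (k + 1) = v k *~ a k + v (k - 1).
  rewrite /v hp hq !mulrzDl !mulrzDr addrACA -!mulrzA.
  by rewrite ![a k * _]mulrC.
have v1 k : (v k).1 = (p k)%:~R - (q k)%:~R * Delta.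
  by rewrite fst_comb /= mulr1 mulrN.
have v0 : v 0 = (1, 1) by rewrite /v hp0 hq0 mulr0z addr0.
have v_1 : v (-1) = (- Delta, - Delta') by rewrite /v hp_1 hq_1 mulr0z add0r.
have v_basis : Lambda = plane_lattice (v 0) (v (-1)) by rewrite v0 v_1.
have v1_sign : forall k, 0 < (if odd `|k|%N then - (v k).1 else (v k).1).
  apply: (alternating_gt0 a (fun k => (v k).1) Delta) => // [k|||].
  - by rewrite vS fst_shear.
  - exact: lt_trans ltr01 hDelta.
  - by rewrite v0.
  - by rewrite v_1.
have v2_gt0 : forall k, 0 < (v k).2.
  apply: (increasing_gt0 a (fun k => (v k).2) (- Delta')) => // [k|||].
  - by rewrite vS snd_shear.
  - by case/andP: hDelta'; rewrite oppr_gt0.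
  - by rewrite v0.
  - by rewrite v_1.
have B0 : B 0 = chain_box v 0 0.
  rewrite hB0 /chain_box /chain_left /chain_right /= mulr0z add0r.
  by rewrite v0 v_1 /basis_box /= addrC.
have BE := chain_boxE Lambda a v ha vS v_basis v1_sign v2_gt0 B hB B0 i j.
have {}BE := BE ltac:(lia).
have [_ /= -> _] := halpha (signed_partial_sum a i + j).
have [_ /= -> _] := hbeta (signed_partial_sum a i + j).
rewrite BE /= /chain_left /chain_right.
by case: odd; rewrite (fst_shear (v i)) !v1.
Qed.
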